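(* Let $\mathcal F$ be a class of graphs stable by taking subgraphs. If $G,H\in\mathcal F$ are $\mathcal F$-isomorphic, then they are isomorphic.
   Context: Graphs are finite, simple and undirected, with at least one vertex; classes of graphs are nonempty and closed under isomorphism. A subgraph of $G$ is a graph $H$ with $V(H)\subset V(G)$ and $E(H)\subset E(G)$ (not necessarily induced). A graph morphism $f:G\to H$ is a map $V(G)\to V(H)$ sending every edge $xy$ of $G$ to an edge $f(x)f(y)$ of $H$; $\hom(G,H)$ is the number of graph morphisms from $G$ to $H$. Two graphs $G$ and $H$ are $\mathcal F$-isomorphic if $\hom(A,G)=\hom(A,H)$ for all $A\in\mathcal F$. *)

(* Defs.v *)
From HB Require Import structures.
From mathcomp Require Import all_boot.
Set Implicit Arguments.
Unset Strict Implicit.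
Unset Printing Implicit Defensive.

Record graph := Graph {
  vertex :> finType;
  edge : rel vertex;
  edge_sym : symmetric edge;
  edge_irr : irreflexive edge;
  vertex_gt0 : 0 < #|vertex|
}.

Definition is_morphism (G H : graph) (f : {ffun G -> H}) : bool :=
  [forall x, forall y, edge x y ==> edge (f x) (f y)].

Definition hom (G H : graph) : nat := #|[set f : {ffun G -> H} | is_morphism f]|.

Definition isomorphic (G H : graph) : Prop :=
  exists2 f : G -> H, bijective f & forall x y, edge (f x) (f y) = edge x y.

(* A not necessarily induced subgraph, given by V(H) as a subset of V(G) and
   E(H) as a relation on V(G); subgraphs, like all graphs, are nonempty. *)
Record subgraph (G : graph) := Subgraph {
  sub_vertex : {set G};
  sub_edge : rel G;
  sub_edge_sym : symmetric sub_edge;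
  sub_edgeP : forall x y, sub_edge x y ->
    [/\ x \in sub_vertex, y \in sub_vertex & edge x y];
  sub_vertex_neq0 : sub_vertex != set0
}.

Section GraphOfSubgraph.
Variables (G : graph) (K : subgraph G).

Let V : finType := {x : G | x \in sub_vertex K}.
Let e : rel V := fun x y => sub_edge K (val x) (val y).

Fact graph_of_subgraph_sym : symmetric e.
Proof. by move=> x y; apply: sub_edge_sym. Qed.

Fact graph_of_subgraph_irr : irreflexive e.
Proof.
move=> x; apply/negP => /(@sub_edgeP _ K) [_ _].
by rewrite edge_irr.
Qed.

Fact graph_of_subgraph_gt0 : 0 < #|V|.
Proof. by rewrite card_sig card_gt0; exact: sub_vertex_neq0. Qed.

Definition graph_of_subgraph : graph :=
  Graph graph_of_subgraph_sym graph_of_subgraph_irr graph_of_subgraph_gt0.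
End GraphOfSubgraph.

Coercion graph_of_subgraph : subgraph >-> graph.

(* A class is a predicate on graphs, in general not decidable. *)
Definition is_graph_class (F : graph -> Prop) : Prop :=
  (exists G, F G) /\ (forall G H, isomorphic G H -> F G -> F H).

Definition subgraph_stable (F : graph -> Prop) : Prop :=
  forall G, F G -> forall K : subgraph G, F K.

Definition class_isomorphic (F : graph -> Prop) (G H : graph) : Prop :=
  forall A, F A -> hom A G = hom A H.

(* Main.v *)
Require Import Defs.
From mathcomp Require Import all_boot.

(** Let [inj(A, X)] be the number of injective morphisms from [A] to [X]. By
    strong induction on the order of [A], [inj(A, G) = inj(A, H)] for every [A]
    in the class: sort the morphisms out of [A] by their kernel. If some
    morphism [f] from [A] to [G] (or [H]) has a given kernel, then the morphisms
    from [A] to [X] with that kernel are the injective morphisms to [X] from the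
    image of [f], which is a subgraph of [G] (or [H]), hence in the class, and
    is smaller than [A] unless [f] is injective. Taking [A := G] and [A := H],
    each of [G] and [H] embeds into the other. *)

Set Implicit Arguments.
Unset Strict Implicit.
Unset Printing Implicit Defensive.

Lemma morphismP (G H : graph) (f : {ffun G -> H}) :
  reflect (forall x y, edge x y -> edge (f x) (f y)) (is_morphism f).
Proof.
apply: (iffP forallP) => [fM x y | fM x]; first exact/implyP/(forallP (fM x)).
by apply/forallP=> y; apply/implyP/fM.
Qed.

(** As sets of pairs, kernels live in a finite type over which morphism counts can be summed. A set
    that is the kernel of no morphism contributes 0. *)
Definition ker (T : finType) (U : eqType) (f : T -> U) : {set T * T} :=
  [set p | f p.1 == f p.2].

Lemma kerE (T : finType) (U : eqType) (f : T -> U) x y :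
  ((x, y) \in ker f) = (f x == f y).
Proof. by rewrite inE. Qed.

Lemma ker_injective (T : finType) (U : eqType) (f : T -> U) :
  ker f = ker id -> injective f.
Proof.
move=> kf x y /eqP fxy.
by apply/eqP; rewrite -[x == y](kerE id) -kf kerE.
Qed.

Lemma eq_ker_id (T : finType) (U : eqType) (f : T -> U) :
  injective f -> ker f = ker id.
Proof. by move=> fI; apply/setP=> -[x y]; rewrite !kerE (inj_eq fI). Qed.

Definition ker_morphisms (A X : graph) (R : {set A * A}) : {set {ffun A -> X}} :=
  [set f | is_morphism f & ker f == R].

Definition inj_hom (A X : graph) : nat := #|ker_morphisms X (ker (@id A))|.

Lemma hom_sum_ker (A X : graph) : hom A X = \sum_R #|@ker_morphisms A X R|.
Proof.
rewrite /hom -sum1_card (partition_big (fun f : {ffun A -> X} => ker f) xpredT) //=.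
by apply: eq_bigr => R _; rewrite -sum1_card; apply: eq_bigl => f; rewrite !inE.
Qed.

Lemma inj_hom_gt0P (A X : graph) :
  reflect (exists2 f : {ffun A -> X}, injective f & is_morphism f)
          (0 < inj_hom A X).
Proof.
rewrite /inj_hom card_gt0; apply: (iffP (set0Pn _)).
  by case=> f; rewrite inE => /andP[fM /eqP/ker_injective fI]; exists f.
by case=> f fI fM; exists f; rewrite inE fM eq_ker_id /=.
Qed.

Lemma inj_hom_refl_gt0 (A : graph) : 0 < inj_hom A A.
Proof.
apply/inj_hom_gt0P; exists [ffun x => x]; first by move=> x y; rewrite !ffunE.
by apply/morphismP=> x y; rewrite !ffunE.
Qed.

(** The hypotheses make [B] the quotient of [A] by [ker p], so composition with [p] is a bijection
    from the injective morphisms on [B] to the morphisms on [A] with kernel [ker p]. *)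
Lemma card_ker_morphisms_quotient (A B X : graph) (p : A -> B) :
    (forall u, exists x, p x = u) ->
    (forall x y, edge x y -> edge (p x) (p y)) ->
    (forall u v, edge u v -> exists x y, [/\ edge x y, p x = u & p y = v]) ->
  #|ker_morphisms X (ker p)| = inj_hom B X.
Proof.
move=> p_surj pM p_surjE.
have [s sK] : exists s, forall u, p (s u) = u by exact: (@fin_all_exists B (fun=> A) (fun u x => p x = u)).
pose lift (g : {ffun B -> X}) := [ffun x => g (p x)] : {ffun A -> X}.
have lift_inj : injective lift.
  move=> g h /ffunP gh; apply/ffunP=> u.
  by have := gh (s u); rewrite !ffunE sK.
rewrite /inj_hom -(card_imset _ lift_inj); apply: eq_card => h.
apply/idP/imsetP; last first.
  case=> g; rewrite inE => /andP[/morphismP gM /eqP/ker_injective gI] ->.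
  rewrite inE; apply/andP; split.
    by apply/morphismP=> x y xy; rewrite !ffunE gM ?pM.
  by apply/eqP/setP=> -[x y]; rewrite !kerE !ffunE (inj_eq gI).
rewrite inE => /andP[/morphismP hM /eqP/setP hp].
have hE x y : (h x == h y) = (p x == p y) by rewrite -!kerE hp.
have hs x : h (s (p x)) = h x by apply/eqP; rewrite hE sK.
(* Since [h] and [p] have the same kernel, [h] factors through [p], and the choice of the section
   [s] does not matter. *)
exists [ffun u => h (s u)]; last by apply/ffunP=> x; rewrite !ffunE hs.
rewrite inE; apply/andP; split.
  apply/morphismP=> u v /p_surjE[x [y [xy <- <-]]].
  by rewrite !ffunE !hs hM.
by apply/eqP/eq_ker_id => u v; rewrite !ffunE => /eqP; rewrite hE !sK => /eqP.
Qed.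

Section ImageSubgraph.
Variables (A G : graph) (f : {ffun A -> G}) (fM : is_morphism f).

(** Only images of edges of [A] are kept, so the image need not be induced: every edge of it must
    lift to [A] for the quotient argument. *)
Let im_edge : rel G :=
  fun u v => [exists x, exists y, [&& edge x y, f x == u & f y == v]].

Fact im_edge_sym : symmetric im_edge.
Proof.
suff im_sym u v : im_edge u v -> im_edge v u by move=> u v; apply/idP/idP; apply: im_sym.
case/existsP=> x /existsP[y /and3P[xy xu yv]].
by apply/existsP; exists y; apply/existsP; exists x; rewrite edge_sym xy yv xu.
Qed.

Fact im_edgeP u v : im_edge u v ->
  [/\ u \in f @: [set: A], v \in f @: [set: A] & edge u v].
Proof.
case/existsP=> x /existsP[y /and3P[xy /eqP<- /eqP<-]].
by rewrite !imset_f //; split=> //; apply: (morphismP _ fM).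
Qed.

Fact im_neq0 : f @: [set: A] != set0.
Proof.
have /card_gt0P[x _] := vertex_gt0 A.
by apply/set0Pn; exists (f x); apply: imset_f.
Qed.

Definition image_subgraph : subgraph G := Subgraph im_edge_sym im_edgeP im_neq0.

Lemma card_image_subgraph : #|image_subgraph| = #|f @: [set: A]|.
Proof. exact: card_sig. Qed.

Lemma card_ker_morphisms_image (X : graph) :
  #|ker_morphisms X (ker f)| = inj_hom image_subgraph X.
Proof.
have fA x : f x \in f @: [set: A] by apply: imset_f.
pose p x : image_subgraph := exist _ (f x) (fA x).
have -> : ker f = ker p by apply/setP=> -[x y]; rewrite !kerE.
apply: card_ker_morphisms_quotient.
- by move=> [u uA]; have /imsetP[x _ ux] := uA; exists x; apply: val_inj.
- move=> x y xy; apply/existsP; exists x; apply/existsP; exists y.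
  by rewrite xy !eqxx.
- move=> u v /existsP[x /existsP[y /and3P[xy /eqP xu /eqP yv]]].
  by exists x, y; split=> //; apply: val_inj.
Qed.

End ImageSubgraph.

Section ClassIsomorphic.
Variables (F : graph -> Prop) (F_sub : subgraph_stable F).

(** A morphism to [G] with kernel [R] has its image in the class, and this one image computes both
    sides. *)
Lemma card_ker_morphisms_eq (A G H : graph) (R : {set A * A}) :
    F G -> R != ker id ->
    (forall B, F B -> #|B| < #|A| -> inj_hom B G = inj_hom B H) ->
    0 < #|ker_morphisms G R| ->
  #|ker_morphisms G R| = #|ker_morphisms H R|.
Proof.
move=> FG R_nid IH /card_gt0P[f]; rewrite inE => /andP[fM /eqP kf].
rewrite -kf in R_nid *; rewrite !(card_ker_morphisms_image fM).
apply: IH; first exact: F_sub.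
rewrite card_image_subgraph -cardsT ltn_neqAle leq_imset_card andbT.
(* An image as large as [A] would force [f] to be injective, with kernel [ker id]. *)
apply: contra R_nid => /imset_injP fI.
by apply/eqP/eq_ker_id => x y; apply: fI; rewrite inE.
Qed.

Lemma inj_hom_class_isomorphic (G H A : graph) :
  F G -> F H -> class_isomorphic F G H -> F A -> inj_hom A G = inj_hom A H.
Proof.
move=> FG FH GH; have [n] := ubnP #|A|.
elim: n A => // n IHn A ltAn FA.
have IH B : F B -> #|B| < #|A| -> inj_hom B G = inj_hom B H.
  by move=> FB ltBA; apply: IHn => //; apply: leq_trans ltBA _.
have := GH A FA; rewrite !hom_sum_ker.
(* The term of the injective morphisms is isolated; the other terms agree one by one and cancel. *)
rewrite (bigD1 (ker id)) //= [in RHS](bigD1 (ker id)) //=.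
rewrite (eq_bigr (fun R => #|ker_morphisms H R|)); first by move/addIn.
move=> R R_nid.
(* Either [R] is realized in [G], or only in [H], where the roles are exchanged, or both counts are
   0. *)
have [G0 | ] := posnP #|ker_morphisms G R|; last exact: card_ker_morphisms_eq.
have [H0 | ] := posnP #|ker_morphisms H R|; first by rewrite G0.
move=> H_gt0; apply/esym/card_ker_morphisms_eq => // B FB ltBA.
by rewrite IH.
Qed.

End ClassIsomorphic.

Definition edge_set (G : graph) : {set G * G} := [set p | edge p.1 p.2].

Definition map_pair (T U : Type) (f : T -> U) (p : T * T) : U * U :=
  (f p.1, f p.2).

Lemma map_pair_inj (T U : Type) (f : T -> U) :
  injective f -> injective (map_pair f).
Proof. by move=> fI [x y] [z t] [/fI-> /fI->]. Qed.

Lemma map_edge_set_sub (G H : graph) (f : {ffun G -> H}) :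
  is_morphism f -> map_pair f @: edge_set G \subset edge_set H.
Proof.
move=> /morphismP fM; apply/subsetP=> _ /imsetP[[x y] + ->].
by rewrite !inE; apply: fM.
Qed.

Lemma inj_hom_card_edge_set (G H : graph) :
  0 < inj_hom G H -> #|edge_set G| <= #|edge_set H|.
Proof.
case/inj_hom_gt0P=> f fI fM; rewrite -(card_imset _ (map_pair_inj fI)).
exact/subset_leq_card/map_edge_set_sub.
Qed.

(** By finiteness, the two embeddings force equal numbers of vertices and of edges; hence [f] is
    bijective on both and reflects edges. *)
Lemma inj_hom_antisym (G H : graph) :
  0 < inj_hom G H -> 0 < inj_hom H G -> isomorphic G H.
Proof.
move=> GH HG; have [f fI fM] := inj_hom_gt0P _ _ GH.
have [g gI _] := inj_hom_gt0P _ _ HG.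
exists f; first exact: inj_card_bij fI (leq_card g gI).
have fE : map_pair f @: edge_set G = edge_set H.
  apply/eqP; rewrite eqEcard map_edge_set_sub //.
  by rewrite card_imset ?inj_hom_card_edge_set //; apply: map_pair_inj.
move=> x y; have : map_pair f (x, y) \in edge_set H = ((x, y) \in edge_set G).
  by rewrite -fE mem_imset //; apply: map_pair_inj.
by rewrite !inE.
Qed.

Theorem theoremA12 (F : graph -> Prop) (F_class : is_graph_class F)
    (F_sub : subgraph_stable F) (G H : graph) (FG : F G) (FH : F H)
    (GH : class_isomorphic F G H) : isomorphic G H.
Proof.
have eqGH A : F A -> inj_hom A G = inj_hom A H.
  exact: inj_hom_class_isomorphic.
apply: inj_hom_antisym; first by rewrite -eqGH ?inj_hom_refl_gt0.
by rewrite eqGH ?inj_hom_refl_gt0.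
Qed.
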